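(* Suppose the Markov chain is irreducible and positive recurrent with $V$ finite, and let $\pi$ be its stationary distribution (so $\sum_{v\in V}\pi(v)=1$). Let $b\in V$, let $k(v):=\mathbb{E}_v T_b$ for $v\in V$, and let $$K_4:=\max_{v\in V} k(v)+\frac12\Big(\frac{d(b)}{\pi(b)}+\sum_{u,v\in V} d(u)\,p(u,v)\,|k(u)-k(v)-1|\Big).$$ Then for any rotor walk $x_0,x_1,\ldots$ associated with the chain (any initial vertex and any initial rotor configuration) and for all $t\ge 1$, $$\Big|\pi(b)-\frac{n_t(b)}{t}\Big| \leq \frac{K_4\,\pi(b)}{t}.$$
   Context: Markov chain: $p:V\times V\to[0,1]$ are the transition probabilities of a Markov chain $X_0,X_1,\ldots$ on $V$; all $p(u,v)$ are rational. $\mathbb{E}_u$ is expectation for the chain started at $X_0=u$. $T_v:=\min\{t\ge 0: X_t=v\}$. Rotor mechanism: to each vertex $u$ are associated a positive integer $d(u)$ and a finite sequence of (not necessarily distinct) vertices $u^{(1)},\ldots,u^{(d(u))}$ (the successors of $u$) such that $p(u,v)=\#\{i:u^{(i)}=v\}/d(u)$ for all $u,v\in V$. Rotor walk: a rotor configuration is a map $r$ assigning to each $v\in V$ an integer $r(v)\in\{1,\ldots,d(v)\}$. Given an initial vertex $x_0$ and an initial rotor configuration $r_0$, the rotor walk is defined inductively: $r_{t+1}(v)=r_t(v)$ for $v\ne x_t$; $r_{t+1}(x_t)=r_t(x_t)+1$ if $r_t(x_t)<d(x_t)$ and $r_{t+1}(x_t)=1$ if $r_t(x_t)=d(x_t)$;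 and $x_{t+1}:=(x_t)^{(r_{t+1}(x_t))}$. $n_t(v):=\#\{s\in\{0,\ldots,t-1\}: x_s=v\}$. *)

(* Defs.v *)
From HB Require Import structures.
From mathcomp Require Import all_boot all_order all_algebra.
From mathcomp Require Import all_classical all_reals all_analysis.

Set Implicit Arguments.
Unset Strict Implicit.
Unset Printing Implicit Defensive.

Import Order.TTheory GRing.Theory Num.Theory.
Import numFieldNormedType.Exports.

Local Open Scope classical_set_scope.
Local Open Scope ring_scope.

Record rational_transition_matrix (R : realType) (V : finType)
    (p : V -> V -> R) : Prop := RationalTransitionMatrix {
  transition_itv : forall u v, 0 <= p u v <= 1 ;
  transition_sum1 : forall u, \sum_v p u v = 1 ;
  transition_rat : forall u v, exists q : rat, p u v = ratr q }.

(* [P u] is the law of the chain started at [u]; all the laws live on a single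
   sample space [Omega], as on the canonical path space.  The Markov property
     P_u(X_{n+1} = x_{n+1} | X_0 = x_0, ..., X_n = x_n) = p(x_n, x_{n+1})
   is written with the denominator cleared, so that it holds trivially when the
   conditioning event is null. *)
Record markov_chain (R : realType) (V : finType) (p : V -> V -> R)
    (disp : measure_display) (Omega : measurableType disp)
    (P : V -> probability Omega R) (X : nat -> Omega -> V) : Prop :=
  MarkovChain {
  chain_measurable : forall n v, measurable [set w | X n w = v] ;
  chain_start : forall u, P u [set w | X 0%N w = u] = 1%E ;
  chain_step : forall (u : V) (x : nat -> V) (n : nat),
    P u [set w | forall i, (i <= n.+1)%N -> X i w = x i] =
    (P u [set w | forall i, (i <= n)%N -> X i w = x i] *
     (p (x n) (x n.+1))%:E)%E }.

Definition irreducible_chain (R : realType) (V : finType)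
    (disp : measure_display) (Omega : measurableType disp)
    (P : V -> probability Omega R) (X : nat -> Omega -> V) : Prop :=
  forall u v, exists n, (0 < P u [set w | X n w = v])%E.

(* Since [ereal_inf set0 = +oo], the two times below are [+oo] on the
   trajectories that do not visit [v]. *)
Definition hitting_time (R : realType) (V : finType) (Omega : Type)
    (X : nat -> Omega -> V) (v : V) (w : Omega) : \bar R :=
  ereal_inf [set (t%:R)%:E | t in [set t : nat | X t w = v]].

Definition return_time (R : realType) (V : finType) (Omega : Type)
    (X : nat -> Omega -> V) (v : V) (w : Omega) : \bar R :=
  ereal_inf [set (t%:R)%:E | t in [set t : nat | (1 <= t)%N /\ X t w = v]].

Definition positive_recurrent (R : realType) (V : finType)
    (disp : measure_display) (Omega : measurableType disp)
    (P : V -> probability Omega R) (X : nat -> Omega -> V) : Prop :=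
  forall v, (\int[P v]_w return_time R X v w < +oo)%E.

(* The real value of E_u T_v, which is finite whenever the chain is irreducible
   on a finite state space. *)
Definition expected_hitting_time (R : realType) (V : finType)
    (disp : measure_display) (Omega : measurableType disp)
    (P : V -> probability Omega R) (X : nat -> Omega -> V) (u v : V) : R :=
  fine (\int[P u]_w hitting_time R X v w)%E.

Record stationary_distribution (R : realType) (V : finType)
    (p : V -> V -> R) (pi : V -> R) : Prop := StationaryDistribution {
  stationary_ge0 : forall v, 0 <= pi v ;
  stationary_sum1 : \sum_v pi v = 1 ;
  stationary_inv : forall v, \sum_u pi u * p u v = pi v }.

(* The positions u^(1), ..., u^(d(u)) of the successors of [u] are numbered
   0, ..., d(u) - 1. *)
Record rotor_mechanism (R : realType) (V : finType) (p : V -> V -> R)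
    (d : V -> nat) (succ : forall u, (d u).-tuple V) : Prop :=
  RotorMechanism {
  rotor_deg_gt0 : forall u, (0 < d u)%N ;
  rotor_transition : forall u v,
    p u v = #|[pred i : 'I_(d u) | tnth (succ u) i == v]|%:R / (d u)%:R }.

(* [ordS] is the successor modulo [d (x t)]: the rotor at the current vertex is
   incremented first, and the walk then follows the updated rotor. *)
Record rotor_walk (V : finType) (d : V -> nat)
    (succ : forall u, (d u).-tuple V)
    (x : nat -> V) (r : nat -> forall v, 'I_(d v)) : Prop := RotorWalk {
  rotor_stay : forall t v, v != x t -> r t.+1 v = r t v ;
  rotor_turn : forall t, r t.+1 (x t) = ordS (r t (x t)) ;
  rotor_move : forall t, x t.+1 = tnth (succ (x t)) (r t.+1 (x t)) }.

Definition visits (V : finType) (x : nat -> V) (t : nat) (v : V) : nat :=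
  #|[pred s : 'I_t | x s == v]|.

(* Main.v *)
(** The function [k v = E_v T_b] satisfies [k u = 1 + sum_v p u v * k v] off
    [b], and stationarity then gives [pi b * (1 + sum_v p b v * k v) = 1].
    Hence
      [g u v = k u - k v - 1 + [u = b] / pi b]
    has mean zero over the successors of every [u], while its sum along the
    first [t] steps of the walk is [k (x 0) - k (x t) - t + n_t(b) / pi b].
    The rotor at [u] runs cyclically through the successors, so its
    contribution to this sum is a partial sum, over an interval of positions,
    of a zero-sum sequence; it is at most half of the sum of the absolute
    values.

    The recursion for [k] comes from [E_u T_b = sum_n P_u(T_b > n)], where
    [P_u(T_b > n)] satisfies a backward recursion and decays geometrically by
    irreducibility. *)

Require Import Defs.
From HB Require Import structures.
From mathcomp Require Import all_boot all_order all_algebra.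
From mathcomp Require Import all_classical all_reals all_analysis.
From mathcomp Require Import measurable_realfun.
From mathcomp Require Import ring lra.

Set Implicit Arguments.
Unset Strict Implicit.
Unset Printing Implicit Defensive.

Import Order.TTheory GRing.Theory Num.Theory.
Import numFieldNormedType.Exports.

Local Open Scope ring_scope.

(** * Rotor walks *)

(** The sums over [A] and over its complement are opposite, hence of equal absolute value, and
    together they cost at most the sum of all the absolute values. *)
Lemma half_norm_sum (R : realFieldType) (n : nat) (F : 'I_n -> R)
    (A : pred 'I_n) : \sum_i F i = 0 ->
  `|\sum_(i | A i) F i| <= 2^-1 * \sum_i `|F i|.
Proof.
rewrite (bigID A) /= => /eqP; rewrite addr_eq0 => /eqP AE.
rewrite [X in _ <= _ * X](bigID A) /=.
have le1 : `|\sum_(i | A i) F i| <= \sum_(i | A i) `|F i|.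
  exact: ler_norm_sum.
have : `|\sum_(i | ~~ A i) F i| <= \sum_(i | ~~ A i) `|F i|.
  exact: ler_norm_sum.
by rewrite -normrN -AE; move: le1; lra.
Qed.

(** Up to sign, the difference is the sum of [F] over the positions between [i] and [j], to which
    [half_norm_sum] applies. *)
Lemma half_norm_partial_sums (R : realFieldType) (n : nat) (F : 'I_n -> R)
    (i j : 'I_n) : \sum_l F l = 0 ->
  `|\sum_(l < n | (l <= j)%N) F l - \sum_(l < n | (l <= i)%N) F l|
    <= 2^-1 * \sum_l `|F l|.
Proof.
move=> F0; wlog leij : i j / (i <= j)%N.
  by move=> wl; have [/wl//|/ltnW/wl] := leqP i j; rewrite distrC.
rewrite (bigID (fun l : 'I_n => (l <= i)%N)) /=.
rewrite [X in X + _ - _](eq_bigl (fun l : 'I_n => (l <= i)%N)); last first.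
  by move=> l; rewrite andb_idl // => /leq_trans; apply.
by rewrite addrC addKr; exact: half_norm_sum.
Qed.

(** At the last position the prefix sum is the whole sum, which is zero, so the wrap-around to
    position 0 obeys the same rule as any other step. *)
Lemma partial_sum_ordS (R : zmodType) (n : nat) (F : 'I_n -> R) (i : 'I_n) :
  \sum_l F l = 0 ->
  \sum_(l < n | (l <= ordS i)%N) F l =
  \sum_(l < n | (l <= i)%N) F l + F (ordS i).
Proof.
move=> F0; have := ltn_ord i; rewrite leq_eqVlt => /predU1P[iE|lti].
  have Si0 : ordS i = 0%N :> nat by rewrite /= iE modnn.
  rewrite [X in _ = X + _](_ : _ = 0) ?add0r; last first.
    by rewrite -[RHS]F0; apply: eq_bigl => l; rewrite -ltnS iE ltn_ord.
  rewrite (big_pred1 (ordS i)) // => l.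
  by rewrite -[RHS]/(l == ordS i :> nat) Si0 leqn0.
have SiE : ordS i = i.+1 :> nat by rewrite /= modn_small.
rewrite (bigD1 (ordS i)) //= addrC; rewrite /= in SiE; congr (_ + _).
apply: eq_bigl => l.
by rewrite -[l == _]/(l == ordS i :> nat) /= SiE andbC -ltn_neqAle ltnS.
Qed.

(** The positions are grouped by the vertex they hold: [v] occurs [d u * p u v] times. *)
Lemma sum_successors (R : realType) (V : finType) (p : V -> V -> R)
    (d : V -> nat) (succ : forall u, (d u).-tuple V) (u : V) (g : V -> R) :
  rotor_mechanism p succ ->
  \sum_i g (tnth (succ u) i) = \sum_v (d u)%:R * p u v * g v.
Proof.
move=> [d_gt0 pE]; rewrite (partition_big (tnth (succ u)) xpredT) //=.
apply: eq_bigr => v _; rewrite (eq_bigr (fun=> g v)); last by move=> i /eqP ->.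
rewrite pE mulrCA divff ?pnatr_eq0 -?lt0n // mulr1.
by rewrite sumr_const mulr_natl.
Qed.

(** The bound is uniform in [t] because each rotor contributes a difference of two prefix sums,
    determined by its initial and current positions alone. *)
Lemma rotor_walk_sum (R : realType) (V : finType) (p : V -> V -> R)
    (d : V -> nat) (succ : forall u, (d u).-tuple V)
    (x : nat -> V) (r : nat -> forall v, 'I_(d v)) (g : V -> V -> R) (t : nat) :
  rotor_mechanism p succ -> rotor_walk succ x r ->
  (forall u, \sum_v p u v * g u v = 0) ->
  `|\sum_(s < t) g (x s) (x s.+1)|
    <= 2^-1 * \sum_u \sum_v (d u)%:R * p u v * `|g u v|.
Proof.
move=> hrot [stay turn move_] g0.
pose F u i := g u (tnth (succ u) i).
have F0 u : \sum_i F u i = 0.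
  rewrite (sum_successors u (g u) hrot).
  by under eq_bigr do rewrite -mulrA; rewrite -mulr_sumr g0 mulr0.
(* The increments of a rotor cancel over a full turn, so the sum of [g] along
   the walk telescopes to a difference of the rotor potentials [H]. *)
pose H u (i : 'I_(d u)) : R := \sum_(l < d u | (l <= i)%N) F u l.
have -> : \sum_(s < t) g (x s) (x s.+1) = \sum_u (H u (r t u) - H u (r 0%N u)).
  elim: t => [|t IH]; first by rewrite big_ord0 big1 // => u _; rewrite subrr.
  rewrite big_ord_recr /= IH (bigD1 (x t)) //= [RHS](bigD1 (x t)) //=.
  rewrite [X in _ = _ + X](eq_bigr (fun u => H u (r t u) - H u (r 0%N u))).
    have FE : F (x t) (ordS (r t (x t))) = g (x t) (x t.+1).
      by rewrite /F -turn -move_.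
    have HE : H (x t) (r t.+1 (x t)) = H (x t) (r t (x t)) + g (x t) (x t.+1).
      by rewrite turn /H partial_sum_ordS // FE.
    by rewrite HE; ring.
  by move=> u /stay ->.
rewrite mulr_sumr; apply: (le_trans (ler_norm_sum _ _ _)).
apply: ler_sum => u _; apply: (le_trans (half_norm_partial_sums _ _ (F0 u))).
by rewrite (sum_successors u (fun v => `|g u v|) hrot).
Qed.

(** * Markov property *)

Local Open Scope classical_set_scope.

Lemma measure_finType_partition (R : realType) (disp : measure_display)
    (Omega : measurableType disp) (P : probability Omega R) (T : finType)
    (Y : Omega -> T) (A : set Omega) :
  measurable A -> (forall t, measurable [set w | Y w = t]) ->
  fine (P A) = \sum_t fine (P (A `&` [set w | Y w = t])).
Proof.
move=> mA mY.
have -> : A = \bigcup_(t in [set` enum T]) (A `&` [set w | Y w = t]).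
  apply/seteqP; split=> [w Aw|w [t _ []]//].
  by exists (Y w) => //=; rewrite mem_enum.
rewrite measure_fin_bigcup //; last 2 first.
- move=> s t _ _ [w [[_ ws] [_ wt]]]; rewrite /= in ws wt.
  by rewrite -ws -wt.
- by move=> t _; apply: measurableI.
rewrite -fsbig_seq ?enum_uniq //= big_enum /= -sum_fine; last first.
  by move=> t _; apply: fin_num_measure; apply: measurableI.
apply: eq_bigr => t _; congr (fine (P _)).
apply/seteqP; split => [w [Aw wt]|w [[s _ [Aw _]] wt]] //.
by split => //; exists t => //=; rewrite mem_enum.
Qed.

Lemma measurable_path (R : realType) (V : finType) (p : V -> V -> R)
    (disp : measure_display) (Omega : measurableType disp)
    (P : V -> probability Omega R) (X : nat -> Omega -> V) (n : nat)
    (Q : pred {ffun 'I_n -> V}) :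
  markov_chain p P X -> measurable [set w | Q [ffun i : 'I_n => X i w]].
Proof.
move=> [mX _ _].
have -> : [set w | Q [ffun i : 'I_n => X i w]] =
  \bigcup_(f in [set` Q]) \bigcap_(i in [set: 'I_n]) [set w | X i w = f i].
  apply/seteqP; split => [w Qw|w [f Qf fw]] /=.
    by exists [ffun i : 'I_n => X i w] => //= i _; rewrite ffunE.
  rewrite (_ : [ffun i : 'I_n => X i w] = f) //.
  by apply/ffunP => i; rewrite ffunE fw.
apply: fin_bigcup_measurable; first exact: finite_finset.
move=> f _; apply: fin_bigcap_measurable => [|i _]; first exact: finite_finset.
exact: mX.
Qed.

(** [chain_step] speaks of one prescribed path; summing it over the finitely many paths in [Q]
    extends it to every event on the first [n.+1] positions that fixes the last of them. *)
Lemma markov_property (R : realType) (V : finType) (p : V -> V -> R)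
    (disp : measure_display) (Omega : measurableType disp)
    (P : V -> probability Omega R) (X : nat -> Omega -> V)
    (u v w : V) (n : nat) (Q : pred {ffun 'I_n.+1 -> V}) :
  markov_chain p P X -> (forall f, Q f -> f ord_max = w) ->
  fine (P u ([set o | Q [ffun i : 'I_n.+1 => X i o]] `&`
             [set o | X n.+1 o = v])) =
  fine (P u [set o | Q [ffun i : 'I_n.+1 => X i o]]) * p w v.
Proof.
move=> hX Qw; have [mX _ step] := hX.
have mQ := measurable_path Q hX.
have mY f : measurable [set o | [ffun i : 'I_n.+1 => X i o] = f].
  have -> : [set o | [ffun i : 'I_n.+1 => X i o] = f] =
            [set o | pred1 f [ffun i : 'I_n.+1 => X i o]].
    by apply/seteqP; split => o /= /eqP.
  exact: measurable_path hX.
rewrite (measure_finType_partition _ _ mY); last exact: measurableI.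
rewrite (measure_finType_partition _ mQ mY) mulr_suml; apply: eq_bigr => f _.
have [Qf|nQf] := boolP (Q f); last first.
  rewrite [X in P u X](_ : _ = set0); last first.
    by rewrite -subset0 => o [[/= + _] fo]; rewrite fo (negPf nQf).
  rewrite [X in _ = fine (P u X) * _](_ : _ = set0); last first.
    by rewrite -subset0 => o [/= + fo]; rewrite fo (negPf nQf).
  by rewrite measure0 mul0r.
(* [chain_step] expects an infinite sequence: [x] follows [f] up to time [n] and stays at [v]
   afterwards. *)
pose x i := if (i <= n)%N then f (inord i) else v.
have xE (i : 'I_n.+1) : x i = f i by rewrite /x -ltnS ltn_ord inord_val.
have xn : x n = w.
  by rewrite /x leqnn -(Qw f Qf); congr (f _); apply/val_inj; rewrite /= inordK.
have xn1 : x n.+1 = v by rewrite /x ltnn.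
have YE : [set o | [ffun i : 'I_n.+1 => X i o] = f] =
          [set o | forall i, (i <= n)%N -> X i o = x i].
  apply/seteqP; split => o /=.
    by move=> fo i lein; rewrite /x lein -fo ffunE inordK.
  by move=> oP; apply/ffunP => i; rewrite ffunE oP ?xE // -ltnS.
have cylE : [set o | Q [ffun i : 'I_n.+1 => X i o]] `&`
    [set o | X n.+1 o = v] `&` [set o | [ffun i : 'I_n.+1 => X i o] = f] =
    [set o | forall i, (i <= n.+1)%N -> X i o = x i].
  apply/seteqP; split => [z [[Qo ov] + ]|z zP].
    rewrite YE => oP i; rewrite leq_eqVlt.
    by move=> /predU1P[->|/oP//]; rewrite xn1.
  have fz : [set o | [ffun i : 'I_n.+1 => X i o] = f] z.
    by rewrite YE => i lein; apply: zP; rewrite ltnW.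
  by split => //; split; rewrite /= ?fz // zP ?xn1.
rewrite cylE step xn xn1 -YE fineM ?fin_num_measure //.
congr (fine (P u _) * _).
by apply/seteqP; split => [z fz|z []//]; split => //=; rewrite fz.
Qed.

(** * Hitting times *)

(** This is P_u(T_b > n), written as the transition operator killed at [b], iterated [n] times on
    the indicator of the complement of [b]. *)
Definition avoid (R : realType) (V : finType) (p : V -> V -> R) (b : V)
    (n : nat) : V -> R :=
  iter n (fun f u => (u != b)%:R * \sum_v p u v * f v) (fun u => (u != b)%:R).

Lemma avoidS (R : realType) (V : finType) (p : V -> V -> R) (b : V)
    (n : nat) (u : V) :
  avoid p b n.+1 u = (u != b)%:R * \sum_v p u v * avoid p b n v.
Proof. by []. Qed.

Lemma avoid_ge0 (R : realType) (V : finType) (p : V -> V -> R) (b : V)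
    (n : nat) (u : V) : rational_transition_matrix p -> 0 <= avoid p b n u.
Proof.
move=> [p01 _ _]; elim: n u => [|n IH] u; first by rewrite /avoid /= ler0n.
rewrite avoidS mulr_ge0 // sumr_ge0 // => v _.
by rewrite mulr_ge0 //; case/andP: (p01 u v).
Qed.

Lemma avoid_le1 (R : realType) (V : finType) (p : V -> V -> R) (b : V)
    (n : nat) (u : V) : rational_transition_matrix p -> avoid p b n u <= 1.
Proof.
move=> hp; have [p01 p1 _] := hp; elim: n u => [|n IH] u.
  by rewrite /avoid /= lern1 leq_b1.
rewrite avoidS mulr_ile1 ?ler0n ?lern1 ?leq_b1 //.
  apply: sumr_ge0 => v _; rewrite mulr_ge0 ?avoid_ge0 //.
  by case/andP: (p01 u v).
rewrite -(p1 u); apply: ler_sum => v _; rewrite ler_piMr //.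
by case/andP: (p01 u v).
Qed.

(** The bound propagates from [n = 0] because the killed operator is linear and monotone. *)
Lemma avoid_geometric (R : realType) (V : finType) (p : V -> V -> R) (b : V)
    (N n : nat) (c : R) (u : V) :
  rational_transition_matrix p -> (forall v, avoid p b N v <= c) ->
  avoid p b (n + N) u <= c * avoid p b n u.
Proof.
move=> hp ac; elim: n u => [|n IH] u.
  (* At [u = b] both sides vanish; elsewhere the right-hand side is [c]. *)
  rewrite add0n {2}/avoid /=; have [->|_] := eqVneq u b; last by rewrite mulr1.
  by case: N {ac} => [|N]; rewrite ?avoidS /avoid /= eqxx ?mul0r mulr0.
rewrite addSn !avoidS mulrCA ler_wpM2l // mulr_sumr; apply: ler_sum => v _.
by rewrite mulrCA ler_wpM2l //; case/andP: (transition_itv hp u v).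
Qed.

(** The first [N] terms are at most 1, and each later one is at most [c] times the term [N] places
    before; the bound is the fixed point of [y = N + c * y]. *)
Lemma avoid_sum_bounded (R : realType) (V : finType) (p : V -> V -> R) (b : V)
    (N M : nat) (c : R) (u : V) :
  rational_transition_matrix p -> (0 < N)%N -> c < 1 ->
  (forall v, avoid p b N v <= c) ->
  \sum_(0 <= i < M) avoid p b i u <= N%:R / (1 - c).
Proof.
move=> hp N0 c1 ac; have c0 : 0 <= c.
  by apply: le_trans (ac u); exact: avoid_ge0.
have d0 : 0 < 1 - c by rewrite subr_gt0.
have ND : 0 <= N%:R / (1 - c) by rewrite divr_ge0 // ltW.
elim: M => [|M IH]; first by rewrite big_geq.
(* As [N] is positive, [N + M] terms include the first [M.+1], and removing [N] of them leaves the
   [M] terms of the induction hypothesis. *)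
apply: (@le_trans _ _ (\sum_(0 <= i < N + M) avoid p b i u)).
  rewrite [X in _ <= X](big_cat_nat (n := M.+1)) //=; last first.
    by rewrite addnC -addn1 leq_add2l.
  by rewrite lerDl sumr_ge0 // => i _; exact: avoid_ge0.
rewrite (big_cat_nat (n := N)) ?leq_addr //=.
rewrite -{2}[N]add0n big_addn addKn.
have -> : N%:R / (1 - c) = N%:R + c * (N%:R / (1 - c)) by field; rewrite gt_eqF.
apply: lerD.
  rewrite -[N in X in _ <= X]subn0 -[leRHS]mulr1 mulr_natl -sumr_const_nat.
  by apply: ler_sum => i _; exact: avoid_le1.
apply: le_trans (ler_wpM2l c0 IH); rewrite mulr_sumr; apply: ler_sum => i _.
exact: avoid_geometric.
Qed.

Lemma probability_start (R : realType) (V : finType) (p : V -> V -> R)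
    (disp : measure_display) (Omega : measurableType disp)
    (P : V -> probability Omega R) (X : nat -> Omega -> V) (u v : V) :
  markov_chain p P X -> fine (P u [set w | X 0%N w = v]) = (v == u)%:R.
Proof.
move=> [mX start _]; have [->|vu] := eqVneq v u; first by rewrite start.
apply/eqP; rewrite eq_le fine_ge0 ?measure_ge0 // andbT.
have : (P u [set w | X 0%N w = v] <= P u (~` [set w | X 0%N w = u]))%E.
  apply: le_measure; rewrite ?inE; [exact: mX|exact: measurableC|].
  by move=> w /= -> /eqP; rewrite (negPf vu).
rewrite probability_setC // start subee // => P0.
by rewrite -lee_fin fineK // fin_num_measure.
Qed.

Lemma measurable_avoid (R : realType) (V : finType) (p : V -> V -> R)
    (disp : measure_display) (Omega : measurableType disp)
    (P : V -> probability Omega R) (X : nat -> Omega -> V) (b : V) (n : nat) :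
  markov_chain p P X ->
  measurable [set w | forall i, (i <= n)%N -> X i w != b].
Proof.
move=> [mX _ _].
rewrite (_ : [set _ | _] = \bigcap_(i in `I_n.+1) ~` [set w | X i w = b]).
  apply: fin_bigcap_measurable => [|i _]; first exact: finite_II.
  exact/measurableC/mX.
by apply/seteqP; split => w Xb i /= lein; apply/eqP; exact: Xb.
Qed.

(** The Markov property extends a path at its end under a fixed law [P u], whereas [avoid] recurses
    on the starting vertex. So a forward recursion is proved for [q n v], the probability of
    avoiding [b] up to time [n] and being at [v] then, and it is transposed in [qsum]. *)
Lemma probability_avoid (R : realType) (V : finType) (p : V -> V -> R)
    (disp : measure_display) (Omega : measurableType disp)
    (P : V -> probability Omega R) (X : nat -> Omega -> V) (b u : V) (n : nat) :
  markov_chain p P X ->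
  P u [set w | forall i, (i <= n)%N -> X i w != b] = (avoid p b n u)%:E.
Proof.
move=> hX; have [mX _ _] := hX.
pose Q n v (f : {ffun 'I_n.+1 -> V}) :=
  [forall i, f i != b] && (f ord_max == v).
pose E n v := [set w | Q n v [ffun i : 'I_n.+1 => X i w]].
pose q n v := fine (P u (E n v)).
have EE m v : E m v =
    [set w | forall i, (i <= m)%N -> X i w != b] `&` [set w | X m w = v].
  apply/seteqP; split => w /=; rewrite /E /= /Q.
    move=> /andP[/forallP Xb /eqP]; rewrite ffunE => <-; split => // i lein.
    by have := Xb (inord i); rewrite ffunE inordK.
  move=> [Xb Xv]; rewrite ffunE Xv eqxx andbT; apply/forallP => i.
  by rewrite ffunE; apply: Xb; rewrite -ltnS.
have mE m v : measurable (E m v) by exact: measurable_path hX.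
have qb m : q m b = 0.
  rewrite /q (_ : E m b = set0) ?measure0 // EE -subset0 => w [/= Xb Xmb].
  by have := Xb m (leqnn m); rewrite Xmb eqxx.
have q0 v : v != b -> q 0%N v = (v == u)%:R.
  move=> vb; rewrite -(probability_start u v hX) /q EE; congr (fine (P u _)).
  apply/seteqP; split => [w []//|w /= Xv]; split => // i.
  by rewrite leqn0 => /eqP ->; rewrite Xv.
have qS m v : q m.+1 v = (v != b)%:R * \sum_w q m w * p w v.
  have [->|vb] := eqVneq v b; first by rewrite qb mul0r.
  rewrite mul1r /q (measure_finType_partition _ (mE _ _) (mX m)).
  apply: eq_bigr => w _.
  rewrite -(@markov_property _ _ _ _ _ _ _ u v w m (Q m w) hX); last first.
    by move=> f /andP[_ /eqP].
  congr (fine (P u _)); rewrite -/(E _ _) !EE.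
  apply/seteqP; split => z /= [[Xb ->] Xw].
    by split => //; split => // i lein; apply: Xb; rewrite ltnW.
  split => //; split => // i; rewrite leq_eqVlt.
  move=> /predU1P[->|]; last exact: Xb.
  by rewrite Xw.
(* The killed operator moves from [q] to [f]: [f b = 0] absorbs the factor [(v != b)] of [qS], and
   [q m b = 0] supplies the one in the iterated operator. *)
have qsum m (f : V -> R) : f b = 0 -> \sum_v q m v * f v =
    iter m (fun f u => (u != b)%:R * \sum_v p u v * f v) f u.
  elim: m f => [|m IH] f fb.
    rewrite /= (bigD1 u) //= big1 ?addr0 => [|v vu].
      have [->|ub] := eqVneq u b; first by rewrite fb mulr0.
      by rewrite q0 // eqxx mul1r.
    have [->|vb] := eqVneq v b; first by rewrite fb mulr0.
    by rewrite q0 // (negPf vu) mul0r.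
  rewrite iterSr -IH ?eqxx ?mul0r //.
  under eq_bigr do rewrite qS.
  transitivity (\sum_v \sum_w q m w * (p w v * f v)).
    apply: eq_bigr => v _; have [->|vb] := eqVneq v b.
      by rewrite mul0r mul0r big1 // => w _; rewrite fb !mulr0.
    by rewrite mul1r mulr_suml; apply: eq_bigr => w _; rewrite mulrA.
  rewrite exchange_big; apply: eq_bigr => w _; rewrite -mulr_sumr.
  by have [->|wb] := eqVneq w b; rewrite ?qb ?mul0r ?mul1r.
have mA := measurable_avoid b n hX.
rewrite -[LHS]fineK ?fin_num_measure //; congr (_%:E).
rewrite /avoid -qsum ?eqxx // (measure_finType_partition _ mA (mX n)).
apply: eq_bigr => v _; rewrite -EE -/(q n v).
by have [->|] := eqVneq v b; rewrite ?qb ?mul0r ?mulr1.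
Qed.

(** From each vertex, irreducibility gives a time at which [b] is occupied with positive
    probability; finiteness of [V] makes the time and the bound uniform. *)
Lemma exists_avoid_lt1 (R : realType) (V : finType) (p : V -> V -> R)
    (disp : measure_display) (Omega : measurableType disp)
    (P : V -> probability Omega R) (X : nat -> Omega -> V) (b : V) :
  rational_transition_matrix p -> markov_chain p P X -> irreducible_chain P X ->
  exists N (c : R),
    [/\ (0 < N)%N, c < 1 & forall v, avoid p b N v <= c].
Proof.
move=> hp hX hirr; have [mX _ _] := hX.
have lt1 u : exists n, avoid p b n u < 1.
  have [n Pn] := hirr u b; exists n.
  rewrite -lte_fin -(probability_avoid b u n hX).
  have mb : measurable [set w | X n w = b] by exact: mX.
  apply: (@le_lt_trans _ _ (P u (~` [set w | X n w = b]))).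
    apply: le_measure; rewrite ?inE.
    - exact: measurable_avoid hX.
    - exact: measurableC.
    - by move=> w /= /(_ n (leqnn n)) /eqP.
  rewrite probability_setC // -[P u _]fineK ?fin_num_measure // -EFinB lte_fin.
  by rewrite ltrBlDr ltrDl -lte_fin fineK // fin_num_measure.
have [n nP] := choice lt1.
pose N := \max_u n u.
have Nlt u : avoid p b N.+1 u < 1.
  have le_nN : (n u <= N.+1)%N by apply: leqW; exact: leq_bigmax.
  (* With constant 1, [avoid_geometric] says that [avoid] does not increase with time. *)
  rewrite -(subnKC le_nN); apply: le_lt_trans (nP u).
  rewrite -[leRHS]mul1r; apply: avoid_geometric => // v; exact: avoid_le1.
exists N.+1, (\big[Num.max/0]_u avoid p b N.+1 u); split => //.
  by apply: bigmax_lt => //; exact: ltr01.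
by move=> v; exact: le_bigmax.
Qed.

(** The terms are the indicators of T_b > n: a first visit at time [m] yields exactly [m] ones, and
    without a visit both sides are [+oo]. *)
Lemma hitting_time_series (R : realType) (V : finType) (Omega : Type)
    (X : nat -> Omega -> V) (b : V) (w : Omega) :
  hitting_time R X b w =
  (\sum_(0 <= n <oo) (\1_[set w | forall i, (i <= n)%N -> X i w != b] w)%:E)%E.
Proof.
have [[t tb]|nhit] := pselect (exists t, X t w == b).
  have ex_b : exists t, X t w == b by exists t.
  case: (ex_minnP ex_b) => m /eqP mb mmin.
  have avoidE n : [set w | forall i, (i <= n)%N -> X i w != b] w <-> (n < m)%N.
    split => /= [Xb|ltnm i lein].
      by rewrite ltnNge; apply/negP => /Xb; rewrite mb eqxx.
    apply/negP => /mmin; rewrite leqNgt => /negP; apply.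
    exact: leq_ltn_trans ltnm.
  transitivity (m%:R%:E : \bar R).
    apply/eqP; rewrite eq_le; apply/andP; split.
      by apply: ereal_inf_lbound; exists m.
    apply: le_ereal_inf_tmp => _ [s /= sb <-]; rewrite lee_fin ler_nat.
    by apply: mmin; apply/eqP.
  rewrite (nneseries_split 0 m); last by move=> k _; rewrite lee_fin.
  rewrite [X in (_ + X)%E]eseries0 ?adde0 => [|k]; last first.
    rewrite add0n => mk _; rewrite indicE memNset //.
    by move=> /avoidE; rewrite ltnNge mk.
  rewrite add0n (eq_big_nat _ _ (F2 := fun=> 1%E)); last first.
    by move=> k /andP[_ km]; rewrite indicE mem_set //; apply/avoidE.
  by rewrite sumEFin sumr_const_nat subn0.
have avoidE n : [set w | forall i, (i <= n)%N -> X i w != b] w.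
  by move=> i _; apply/negP => Xb; apply: nhit; exists i.
transitivity (+oo : \bar R)%E.
  rewrite /hitting_time (_ : [set _ | _ in _] = set0) ?ereal_inf0 //.
  rewrite -subset0 => _ [s /= sb _]; apply: nhit; exists s; exact/eqP.
apply/esym/eqyP => A A0.
apply: le_trans (nneseries_lim_ge (Num.bound A) _); last first.
  by move=> n _ _; rewrite lee_fin.
rewrite (eq_big_nat _ _ (F2 := fun=> 1%E)); last first.
  by move=> k _; rewrite indicE mem_set.
rewrite sumEFin sumr_const_nat subn0 lee_fin ltW //.
by rewrite archi_boundP // ltW.
Qed.

(** The series of indicators is integrated term by term; the geometric bound makes the sum finite,
    so that [fine] returns its true value. *)
Lemma expected_hitting_time_cvg (R : realType) (V : finType) (p : V -> V -> R)
    (disp : measure_display) (Omega : measurableType disp)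
    (P : V -> probability Omega R) (X : nat -> Omega -> V) (b u : V) :
  rational_transition_matrix p -> markov_chain p P X -> irreducible_chain P X ->
  series (avoid p b ^~ u) @ \oo --> expected_hitting_time P X u b.
Proof.
move=> hp hX hirr.
have [N [c [N0 c1 ac]]] := exists_avoid_lt1 b hp hX hirr.
have cv : cvgn (series (avoid p b ^~ u)).
  apply: nondecreasing_is_cvgn.
    by apply: nondecreasing_series => i _ _; exact: avoid_ge0.
  by exists (N%:R / (1 - c)) => _ [M _ <-]; exact: avoid_sum_bounded.
rewrite /expected_hitting_time.
under eq_integral do rewrite hitting_time_series.
rewrite integral_nneseries //; last first.
  move=> n; apply/measurable_EFinP/measurable_indic; exact: measurable_avoid hX.
rewrite (eq_eseriesr (g := fun n => (avoid p b n u)%:E)); last first.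
  move=> n _; rewrite integral_indic ?setIT //; last exact: measurable_avoid hX.
  exact: probability_avoid.
rewrite [X in fine X](_ : _ = (limn (series (avoid p b ^~ u)))%:E) //.
rewrite -EFin_lim //; apply/congr_lim/funext => n.
by rewrite /= sumEFin.
Qed.

Lemma expected_hitting_time_ge0 (R : realType) (V : finType)
    (disp : measure_display) (Omega : measurableType disp)
    (P : V -> probability Omega R) (X : nat -> Omega -> V) (b u : V) :
  0 <= expected_hitting_time P X u b.
Proof.
apply: fine_ge0; apply: integral_ge0 => w _.
by apply: le_ereal_inf_tmp => _ [t _ <-]; rewrite lee_fin.
Qed.

Lemma expected_hitting_time_first_step (R : realType) (V : finType)
    (p : V -> V -> R) (disp : measure_display) (Omega : measurableType disp)
    (P : V -> probability Omega R) (X : nat -> Omega -> V) (b u : V) :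
  rational_transition_matrix p -> markov_chain p P X -> irreducible_chain P X ->
  expected_hitting_time P X u b =
  (u != b)%:R * (1 + \sum_v p u v * expected_hitting_time P X v b).
Proof.
move=> hp hX hirr.
have cv v := @expected_hitting_time_cvg _ _ _ _ _ _ _ b v hp hX hirr.
have := cv u; rewrite -cvg_shiftS => /(cvg_unique _); apply.
  exact: Rhausdorff.
(* The term of index 0 gives the summand 1, and the recursion for [avoid] turns the others into
   partial sums of length [n]. *)
have -> : [sequence series (avoid p b ^~ u) n.+1]_n =
    (fun n => (u != b)%:R * (1 + \sum_v p u v * series (avoid p b ^~ v) n)).
  apply/funext => n; rewrite /series /= big_nat_recl //= mulrDr mulr1.
  congr (_ + _).
  rewrite [X in _ = _ * X](_ : _ =
      \sum_(0 <= i < n) \sum_v p u v * avoid p b i v).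
    by rewrite mulr_sumr.
  by rewrite exchange_big; apply: eq_bigr => v _; rewrite mulr_sumr.
apply: cvgMr; apply: cvgD; first exact: cvg_cst.
apply: cvg_big => [|v _]; first exact: add_continuous.
by apply: cvgMr; exact: cv.
Qed.

Local Close Scope classical_set_scope.

(** * Discrepancy *)

(** Kac's formula, the second factor being the mean return time to [b] when [k v] is E_v T_b. By
    stationarity [k] and [m] have the same average under [pi]; off [b] they differ by 1, and
    [k b = 0], so [pi b * m b] is the mass off [b]. *)
Lemma stationary_mean_return (R : realType) (V : finType) (p : V -> V -> R)
    (pi k : V -> R) (b : V) :
  stationary_distribution p pi ->
  (forall u, k u = (u != b)%:R * (1 + \sum_v p u v * k v)) ->
  pi b * (1 + \sum_v p b v * k v) = 1.
Proof.
move=> [_ pi1 piE] kE; pose m u := \sum_v p u v * k v.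
have : \sum_u pi u * k u = \sum_u pi u * m u.
  under eq_bigr => v do rewrite -piE mulr_suml.
  rewrite exchange_big; apply: eq_bigr => u _.
  by rewrite mulr_sumr; apply: eq_bigr => v _; rewrite mulrA.
have kb : k b = 0 by rewrite kE eqxx mul0r.
rewrite (bigD1 b) //= [in RHS](bigD1 b) //= kb mulr0 add0r.
rewrite (eq_bigr (fun u => pi u + pi u * m u)); last first.
  by move=> u ub; rewrite kE ub mul1r mulrDr mulr1.
rewrite -/(m b) big_split /= mulrDr mulr1.
by move: pi1; rewrite (bigD1 b) //=; lra.
Qed.

Lemma visits_sum (V : finType) (x : nat -> V) (t : nat) (v : V) :
  visits x t v = (\sum_(s < t) (x s == v))%N.
Proof. by rewrite /visits -sum1_card big_mkcond. Qed.

Lemma rotor_discrepancy (R : realType) (V : finType) (p : V -> V -> R)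
    (d : V -> nat) (succ : forall u, (d u).-tuple V) (pi k : V -> R) (b : V)
    (x : nat -> V) (r : nat -> forall v, 'I_(d v)) (t : nat) :
  (forall u, \sum_v p u v = 1) -> (forall u v, 0 <= p u v) ->
  stationary_distribution p pi -> rotor_mechanism p succ ->
  (forall u, k u = (u != b)%:R * (1 + \sum_v p u v * k v)) ->
  rotor_walk succ x r ->
  `|k (x 0%N) - k (x t) - t%:R + (visits x t b)%:R / pi b|
    <= 2^-1 * ((d b)%:R / pi b +
       \sum_u \sum_v (d u)%:R * p u v * `|k u - k v - 1|).
Proof.
move=> p1 p0 hpi hrot kE hwalk.
have kac := stationary_mean_return hpi kE.
have pib : pi b != 0.
  apply/eqP => pi0; move: kac; rewrite pi0 mul0r => /eqP.
  by rewrite eq_sym oner_eq0.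
pose g u v := k u - k v - 1 + (u == b)%:R / pi b.
have g0 u : \sum_v p u v * g u v = 0.
  have -> : \sum_v p u v * g u v =
      k u - \sum_v p u v * k v - 1 + (u == b)%:R / pi b.
    transitivity (\sum_v (p u v * (k u - 1 + (u == b)%:R / pi b) -
                          p u v * k v)).
      by apply: eq_bigr => v _; rewrite /g; ring.
    by rewrite sumrB -mulr_suml p1; ring.
  (* Off [b] the recursion for [k] gives zero directly; at [b], where [k] vanishes, the correction
     [1 / pi b] cancels the mean return time. *)
  rewrite {1}kE; have [->|ub] := eqVneq u b; last first.
    by rewrite /= mulr1n mulr0n; ring.
  have -> : \sum_v p b v * k v = (pi b)^-1 - 1.
    apply: (mulfI pib); rewrite mulrBr mulfV // mulr1.
    by move: kac; rewrite mulrDr mulr1; lra.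
  by rewrite /= mulr0n mulr1n; ring.
(* The differences of [k] telescope, the [-1] counts the steps, and the correction counts the visits
   to [b] before time [t]. *)
have <- : \sum_(s < t) g (x s) (x s.+1) =
    k (x 0%N) - k (x t) - t%:R + (visits x t b)%:R / pi b.
  rewrite visits_sum; elim: t => [|t IH].
    by rewrite !big_ord0 mul0r; ring.
  by rewrite !big_ord_recr /= IH natrD /g -natr1; ring.
apply: (le_trans (rotor_walk_sum t hrot hwalk g0)).
rewrite ler_wpM2l ?invr_ge0 ?ler0n //.
(* Spreading [d b / pi b] over the successors of [b] allows the triangle inequality to be applied
   pair by pair. *)
have -> : (d b)%:R / pi b =
    \sum_u \sum_v (d u)%:R * p u v * ((u == b)%:R / pi b).
  rewrite (bigD1 b) //= [X in _ = _ + X]big1 => [|u /negPf ->]; last first.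
    by apply: big1 => v _; rewrite mul0r mulr0.
  by rewrite eqxx -mulr_suml -mulr_sumr p1 mulr1n; ring.
rewrite -big_split; apply: ler_sum => u _; rewrite -big_split.
apply: ler_sum => v _; rewrite /= -mulrDr ler_wpM2l ?mulr_ge0 ?ler0n //.
rewrite addrC; apply: le_trans (ler_normD _ _) _; rewrite lerD2l ger0_norm //.
by rewrite divr_ge0 ?ler0n //; case: hpi.
Qed.

Theorem theorem4 (R : realType) (V : finType) (p : V -> V -> R)
  (disp : measure_display) (Omega : measurableType disp)
  (P : V -> probability Omega R) (X : nat -> Omega -> V)
  (d : V -> nat) (succ : forall u, (d u).-tuple V)
  (pi : V -> R) (b : V)
  (hp : rational_transition_matrix p)
  (hX : markov_chain p P X)
  (hirr : irreducible_chain P X)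
  (hrec : positive_recurrent P X)
  (hpi : stationary_distribution p pi)
  (hrotor : rotor_mechanism p succ) :
  let k : V -> R := fun v => expected_hitting_time P X v b in
  let K4 : R :=
    \big[Num.max/k b]_(v : V) k v +
    2^-1 * ((d b)%:R / pi b +
            \sum_(u : V) \sum_(v : V)
              (d u)%:R * p u v * `|k u - k v - 1|) in
  forall (x : nat -> V) (r : nat -> forall v, 'I_(d v)),
    rotor_walk succ x r ->
    forall t : nat, (1 <= t)%N ->
      `|pi b - (visits x t b)%:R / t%:R| <= K4 * pi b / t%:R.
Proof.
move=> k K4 x r hwalk t t1.
have kE u : k u = (u != b)%:R * (1 + \sum_v p u v * k v).
  exact: expected_hitting_time_first_step.
have p0 u v : 0 <= p u v by case/andP: (transition_itv hp u v).
have disc := rotor_discrepancy t (transition_sum1 hp) p0 hpi hrotor kE hwalk.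
have pib : 0 < pi b.
  rewrite lt_def (stationary_ge0 hpi) andbT; apply/eqP => pi0.
  have := stationary_mean_return hpi kE.
  by rewrite pi0 mul0r => /eqP; rewrite eq_sym oner_eq0.
have t0 : 0 < t%:R :> R by rewrite ltr0n.
(* Two values of [k] thus differ by at most the maximum, which accounts for the first term of
   [K4]. *)
have kmax v : 0 <= k v <= \big[Num.max/k b]_v k v.
  by rewrite expected_hitting_time_ge0 le_bigmax.
have /andP[k0 k0M] := kmax (x 0%N); have /andP[kt ktM] := kmax (x t).
(* The second factor is, up to sign, the quantity in [disc] without its two values of [k]. *)
have -> : pi b - (visits x t b)%:R / t%:R =
    pi b / t%:R * (t%:R - (visits x t b)%:R / pi b).
  by field; rewrite !gt_eqF.
have q0 : 0 <= pi b / t%:R by rewrite ltW ?divr_gt0.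
rewrite normrM (ger0_norm q0) -mulrA mulrC ler_wpM2r //.
by move: disc; rewrite /K4 !ler_norml => /andP[]; lra.
Qed.
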